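(* For any $\alpha,\alpha_f\ge0$, $$\eta_{\mathrm{OS}}(1,\alpha,\alpha_f)\ge\eta_{\mathrm{TS}}(1,\alpha,\alpha_f),$$ with strict inequality whenever $\alpha\ne\alpha_f$.
   Context: For $b^{\mathrm L},b^{\mathrm R}\in[0,1]$ and a $2\times2$ matrix $\mathbf C=[c_{xy}]$ with non-negative entries, $G_n$ is the random bipartite graph with $n$ supply and $n$ demand nodes in which, independently over nodes, each supply node is of type 2 (flexible) with probability $b^{\mathrm L}$ and of type 1 (regular) otherwise, each demand node is of type 2 with probability $b^{\mathrm R}$ and of type 1 otherwise, and, conditional on types, a supply node of type $x$ and a demand node of type $y$ are connected independently with probability $c_{xy}/n$ ($n$ large). $M_\star(G_n)$ is the maximum matching size and $\eta(b^{\mathrm L},b^{\mathrm R};\mathbf C)=\lim_{n\to\infty}\mathbb E[M_\star(G_n)]/n$ (the limit exists). For $\alpha,\alpha_f\ge0$ and a flexibility budget $B\in(0,1]$, set $\mathbf C=\begin{bmatrix}2\alpha&\alpha+\alpha_f\\ \alpha+\alpha_f&2\alpha_f\end{bmatrix}$, $\eta_{\mathrm{OS}}(B,\alpha,\alpha_f)=\eta(B,0;\mathbf C)$ (one-sided allocation) and $\eta_{\mathrm{TS}}(B,\alpha,\alpha_f)=\eta(B/2,B/2;\mathbf C)$ (two-sided allocation). *)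

(* Defs.v *)
(** Finite combinatorics from MathComp; the reals are Stdlib's [R], with its
    MathComp structures from [Rstruct]; limits from Coquelicot. *)
From Stdlib Require Import Reals.
From mathcomp Require Import all_boot all_order all_algebra.
From mathcomp Require Import Rstruct.
From Coquelicot Require Import Rbar Lim_seq.

Set Implicit Arguments.
Unset Strict Implicit.
Unset Printing Implicit Defensive.

Import Order.TTheory GRing.Theory Num.Theory.
Local Open Scope ring_scope.

(** A bipartite graph with [n] supply and [n] demand nodes is its edge set, a
    pair [(i, j)] joining supply node [i] to demand node [j]. *)
Definition bigraph (n : nat) := {set 'I_n * 'I_n}.

Definition is_matching n (G F : bigraph n) : bool :=
  (F \subset G) &&
  [forall e in F, forall f in F, (e.1 == f.1) || (e.2 == f.2) ==> (e == f)].

Definition max_matching n (G : bigraph n) : nat :=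
  \max_(F : bigraph n | is_matching G F) #|F|.

(** Node types: [0 : 'I_2] is type 1 (regular) and [1 : 'I_2] is type 2
    (flexible). *)
Definition typing (n : nat) := {ffun 'I_n -> 'I_2}.

Definition typing_prob (b : R) n (t : typing n) : R :=
  \prod_(i < n) (if t i == 1 then b else 1 - b).

(** The truncation at 1 is inactive as soon as [n] exceeds every entry of [C];
    it makes the law of the graph a probability for every positive [n]. *)
Definition edge_prob (C : 'M[R]_2) (n : nat) (x y : 'I_2) : R :=
  Num.min 1 (C x y / n%:R).

Definition graph_prob (C : 'M[R]_2) n (tL tR : typing n) (G : bigraph n) : R :=
  \prod_(i < n) \prod_(j < n)
    (if (i, j) \in G then edge_prob C n (tL i) (tR j)
     else 1 - edge_prob C n (tL i) (tR j)).

Definition expected_max_matching (bL bR : R) (C : 'M[R]_2) (n : nat) : R :=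
  \sum_(tL : typing n) \sum_(tR : typing n) \sum_(G : bigraph n)
    typing_prob bL tL * typing_prob bR tR * graph_prob C tL tR G
      * (max_matching G)%:R.

(** The sequence takes values in [0, 1] for [bL], [bR] in [0, 1] and
    nonnegative [C], so the projection [real] from [Rbar] loses nothing. *)
Definition eta (bL bR : R) (C : 'M[R]_2) : R :=
  real (Lim_seq (fun n : nat => expected_max_matching bL bR C n / n%:R)).

Definition flex_mx (alpha alphaf : R) : 'M[R]_2 :=
  \matrix_(x < 2, y < 2)
    nth 0 (nth [::] [:: [:: 2 * alpha;      alpha + alphaf];
                        [:: alpha + alphaf; 2 * alphaf    ]] x) y.

Definition eta_OS (B alpha alphaf : R) : R := eta B 0 (flex_mx alpha alphaf).

Definition eta_TS (B alpha alphaf : R) : R :=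
  eta (B / 2) (B / 2) (flex_mx alpha alphaf).

(* Main.v *)
(** Write [c = alpha + alphaf] and [d = (alpha - alphaf) / 2]. The entries of
    [C] are [c] plus a spin [+-d] of each end type, so for [B = 1] one-sided
    allocation is the homogeneous graph of intensity [c] and two-sided allocation
    the graph with independent fair spins. Pass from the first to the second by
    swapping the pairs [(i, j)] one at a time. A swap changes the mean matching
    size by the mean of the spin sum of [(i, j)] times the probability that the
    edge [(i, j)] increases the matching. Adding an edge that meets [(i, j)] can
    only lower this gain, because a matching uses at most one of the two edges;
    hence reversing both spins from positive to negative, which removes edges at
    [i] and at [j] only, raises the gain, and every swap lowers the mean. Once
    half of the columns have been swapped, reversing the spins changes of order
    [n] probabilities by [2 |d| / n], and each matters with probability bounded
    below (no other edge at [i], [j] and [k]); so a swap costs of order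
    [d ^ 2 / n], and all swaps together of order [d ^ 2 n]. *)
Require Import Defs.
From Stdlib Require Import Reals.
From mathcomp Require Import all_boot all_order all_algebra.
From mathcomp Require Import Rstruct ring lra zify.
From Coquelicot Require Import Rbar Lim_seq.

Set Implicit Arguments.
Unset Strict Implicit.
Unset Printing Implicit Defensive.

Import Order.TTheory GRing.Theory Num.Theory.
Local Open Scope ring_scope.

(** * Random subsets with independent elements *)

Definition subset_weight (K : pzRingType) (E : finType) (p : E -> K)
    (A : {set E}) : K :=
  \prod_e (if e \in A then p e else 1 - p e).

Definition random_subset_mean (K : pzRingType) (E : finType) (p : E -> K)
    (f : {set E} -> K) : K :=
  \sum_(A : {set E}) subset_weight p A * f A.

Lemma eq_random_subset_mean (K : pzRingType) (E : finType) (p q : E -> K)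
    (f : {set E} -> K) :
  p =1 q -> random_subset_mean p f = random_subset_mean q f.
Proof.
move=> pq; apply: eq_bigr => A _; congr (_ * _).
by apply: eq_bigr => e _; rewrite pq.
Qed.

Lemma subset_weight_ge0 (K : realFieldType) (E : finType) (p : E -> K) A :
  (forall e, 0 <= p e <= 1) -> 0 <= subset_weight p A.
Proof.
move=> p01; apply: prodr_ge0 => e _.
by case: ifP => _; have := p01 e; lra.
Qed.

Lemma sum_subset_weight (K : comPzRingType) (E : finType) (p : E -> K) :
  \sum_A subset_weight p A = 1.
Proof.
rewrite -bigA_distr big1 // => e _ /=.
by rewrite addrC subrK.
Qed.

(** With the inclusion weights set to 0 on [L], the product of sums expands over all subsets, and
    those meeting [L] contribute 0. *)
Lemma random_subset_mean_disjoint (K : comPzRingType) (E : finType)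
    (p : E -> K) (L : {set E}) :
  random_subset_mean p (fun A => [disjoint A & L]%:R) =
  \prod_(e in L) (1 - p e).
Proof.
pose F e := if e \in L then 0 else p e.
transitivity (\prod_e (F e + (1 - p e))); last first.
  rewrite [RHS]big_mkcond; apply: eq_bigr => e _; rewrite /F.
  by case: ifP => _; rewrite ?add0r // addrC subrK.
rewrite bigA_distr; apply: eq_bigr => A _ /=.
have [dAL|ndAL] := boolP [disjoint A & L].
  rewrite mulr1; apply: eq_bigr => e _; case: ifP => // eA.
  by rewrite /F (disjointFr dAL eA).
have /existsP [e /andP [eA eL]] : [exists e, (e \in A) && (e \in L)].
  apply: contraNT ndAL; rewrite negb_exists => /forallP h.
  rewrite disjoint_subset; apply/subsetP => e eA; rewrite inE.
  by have := h e; rewrite eA.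
by rewrite mulr0 (bigD1 e) //= eA /F eL mul0r.
Qed.

Lemma big_toggle (K : pzRingType) (E : finType) (e : E) (F : {set E} -> K) :
  \sum_A F A = \sum_(A : {set E} | e \notin A) (F (e |: A) + F A).
Proof.
rewrite big_split (bigID (fun A : {set E} => e \notin A)) /= addrC.
congr (_ + _).
rewrite (reindex_onto (fun A => e |: A) (fun A => A :\ e)) /=; last first.
  by move=> A /negPn eA; rewrite setD1K.
apply: eq_bigl => A; rewrite negbK setU11 /=.
apply/eqP/idP => [<-|eA]; first by rewrite !inE eqxx.
exact: setU1K.
Qed.

(** Conditioning on the status of every element other than [e] exhibits the mean as affine in
    [p e]. *)
Lemma random_subset_mean_toggle (K : comPzRingType) (E : finType)
    (p : E -> K) (f : {set E} -> K) (e : E) :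
  random_subset_mean p f =
  \sum_(A : {set E} | e \notin A)
    (\prod_(e' | e' != e) (if e' \in A then p e' else 1 - p e')) *
      (p e * f (e |: A) + (1 - p e) * f A).
Proof.
rewrite /random_subset_mean (big_toggle e); apply: eq_bigr => A eA.
have W B : subset_weight p B = (if e \in B then p e else 1 - p e) *
    \prod_(e' | e' != e) (if e' \in B then p e' else 1 - p e').
  by rewrite /subset_weight (bigD1 e).
rewrite !W setU11 (negPf eA).
rewrite (eq_bigr (fun e' => if e' \in A then p e' else 1 - p e')).
  by ring.
by move=> e' ne; rewrite in_setU1 (negPf ne).
Qed.

(** Finite-difference form of Russo's formula: the slope of the mean in the probability of [e] is
    the mean increment of [f] at [e], which ignores whether [e] was drawn. *)
Lemma random_subset_mean_diff1 (K : comPzRingType) (E : finType)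
    (p q : E -> K) (f : {set E} -> K) (e : E) :
  (forall e', e' != e -> p e' = q e') ->
  random_subset_mean p f - random_subset_mean q f =
  (p e - q e) * random_subset_mean q (fun A => f (e |: A) - f (A :\ e)).
Proof.
move=> pq; rewrite !(random_subset_mean_toggle _ _ e) -sumrB mulr_sumr.
apply: eq_bigr => A eA.
have -> : A :\ e = A.
  by apply/setDidPl; rewrite disjoint_sym disjoints1.
rewrite setUA setUid setU1K //.
rewrite (eq_bigr (fun e' => if e' \in A then q e' else 1 - q e')).
  by ring.
by move=> e' /pq ->.
Qed.

Lemma random_subset_mean_le (K : realFieldType) (E : finType) (p : E -> K)
    (f g : {set E} -> K) :
  (forall e, 0 <= p e <= 1) -> (forall A, f A <= g A) ->
  random_subset_mean p f <= random_subset_mean p g.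
Proof.
move=> p01 fg; apply: ler_sum => A _.
by apply: ler_wpM2l => //; apply: subset_weight_ge0.
Qed.

(* Raise the probabilities from [p] to [q] one element at a time. *)
Lemma random_subset_mean_antitone (K : realFieldType) (E : finType)
    (p q b : E -> K) (f : {set E} -> K) :
  (forall e, p e <= q e) ->
  (forall e r, p e != q e -> (forall e', p e' <= r e' <= q e') ->
    b e <= random_subset_mean r (fun A => f (A :\ e) - f (e |: A))) ->
  \sum_e (q e - p e) * b e <= random_subset_mean p f - random_subset_mean q f.
Proof.
move=> pq gap.
(* In [mix s] the elements of [s] are already raised; it stays between [p] and [q], so [gap] applies
   to it. *)
pose mix (s : seq E) e := if e \in s then q e else p e.
have step (s : seq E) : uniq s ->
    \sum_(e <- s) (q e - p e) * b e <=
    random_subset_mean p f - random_subset_mean (mix s) f.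
  elim: s => [_|e s IH /= /andP [es us]].
    by rewrite big_nil (eq_random_subset_mean (q := p)) ?subrr // => e.
  have dif := @random_subset_mean_diff1 _ _ (mix (e :: s)) (mix s) f e.
  have {}dif := dif (fun e' ne => ltac:(by rewrite /mix inE (negPf ne))).
  rewrite big_cons; have := IH us.
  suff : (q e - p e) * b e <=
      random_subset_mean (mix s) f - random_subset_mean (mix (e :: s)) f by lra.
  rewrite -[leRHS]opprB dif -mulrN {1 2}/mix inE eqxx (negPf es) /=.
  have [<-|ne] := eqVneq (p e) (q e); first by rewrite subrr !mul0r.
  apply: ler_wpM2l; first by rewrite subr_ge0.
  rewrite /random_subset_mean -sumrN.
  under eq_bigr => A _ do rewrite -mulrN opprB.
  apply: gap => // e'; rewrite /mix.
  by case: ifP => _; rewrite lexx ?pq.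
have := step _ (index_enum_uniq E).
suff -> : random_subset_mean (mix (index_enum E)) f = random_subset_mean q f.
  by [].
by apply: eq_random_subset_mean => e; rewrite /mix mem_index_enum.
Qed.

(** * Matchings *)

Definition incident n (e f : 'I_n * 'I_n) : bool := (e.1 == f.1) || (e.2 == f.2).

Lemma matchingP n (G F : bigraph n) :
  reflect (F \subset G /\ {in F &, forall e f, incident e f -> e = f})
    (is_matching G F).
Proof.
apply: (iffP andP) => [[-> /forall_inP h]|[-> h]]; split=> //.
  by move=> e f eF fF ef; have /forall_inP /(_ f fF) /implyP /(_ ef) /eqP := h e eF.
apply/forall_inP => e eF; apply/forall_inP => f fF.
by apply/implyP => ef; rewrite (h e f).
Qed.

Lemma matching_le n (G F : bigraph n) :
  is_matching G F -> (#|F| <= max_matching G)%N.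
Proof. exact: leq_bigmax_cond. Qed.

Lemma max_matchingP n (G : bigraph n) :
  exists2 F, is_matching G F & max_matching G = #|F|.
Proof.
have m0 : is_matching G set0 by apply/matchingP; split=> [|e f];
  rewrite ?sub0set ?inE.
have [|] := @eq_bigmax_cond _ (is_matching G) (fun F => #|F|).
  by apply/card_gt0P; exists set0.
by move=> F mF eqF; exists F.
Qed.

Lemma max_matching_le n (G : bigraph n) : (max_matching G <= n)%N.
Proof.
have [F /matchingP [_ mF] ->] := max_matchingP G.
have inj : {in F &, injective (fun e : 'I_n * 'I_n => e.1)}.
  by move=> e f eF fF ef; apply: mF; rewrite // /incident ef eqxx.
by rewrite -(card_in_imset inj) -[leqRHS]card_ord max_card.
Qed.

Lemma sub_matching n (G G' F : bigraph n) :
  is_matching G F -> F \subset G' -> is_matching G' F.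
Proof. by move=> /matchingP [_ mF] FG; apply/matchingP. Qed.

Lemma max_matchingS n (G G' : bigraph n) :
  G \subset G' -> (max_matching G <= max_matching G')%N.
Proof.
move=> GG; have [F mF ->] := max_matchingP G; apply: matching_le.
apply: (sub_matching mF).
by have /matchingP [FG _] := mF; apply: subset_trans FG GG.
Qed.

(** A maximum matching of [G] remains a matching when [e] joins it. *)
Lemma max_matchingU1 n (G : bigraph n) (e : 'I_n * 'I_n) :
  {in G, forall f, ~~ incident e f} ->
  (max_matching G < max_matching (e |: G))%N.
Proof.
move=> eG; have [F /matchingP [FG mF] ->] := max_matchingP G.
have eF f : f \in F -> ~~ incident e f by move=> /(subsetP FG); apply: eG.
have -> : #|F|.+1 = #|e |: F|.
  by rewrite cardsU1; have [/eF|//] := boolP (e \in F); rewrite /incident eqxx.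
apply/matching_le/matchingP; split; first exact: setUS.
have sym f g : @incident n f g = incident g f.
  by rewrite /incident (eq_sym f.1) (eq_sym f.2).
move=> f g /setU1P [->|fF] /setU1P [->|gF] // fg; last exact: mF.
- by move: fg; rewrite (negPf (eF _ gF)).
- by move: fg; rewrite sym (negPf (eF _ fF)).
Qed.

(** The increment of [random_subset_mean_diff1] for the matching size; its value does not depend on
    whether [e] lies in [G]. *)
Definition matching_gain (K : pzRingType) n (e : 'I_n * 'I_n) (G : bigraph n) : K :=
  (max_matching (e |: G))%:R - (max_matching (G :\ e))%:R.

Arguments matching_gain {K n} e G.

(* A matching cannot use both of two incident edges. *)
Lemma matching_gain_decreasing (K : realFieldType) n (e f : 'I_n * 'I_n)
    (G : bigraph n) :
  incident e f -> e != f ->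
  matching_gain e (f |: G) <= matching_gain e (G :\ f) :> K.
Proof.
move=> ef nef; rewrite /matching_gain.
suff : (max_matching (e |: (f |: G)) + max_matching ((G :\ f) :\ e) <=
        max_matching (e |: (G :\ f)) + max_matching ((f |: G) :\ e))%N.
  by rewrite lerBlDr addrAC lerBrDr -!natrD ler_nat.
(* [F] misses [e] or [f], so it survives in one of the two graphs on the right; the other one
   contains [(G :\ f) :\ e]. *)
have [F mF ->] := max_matchingP (e |: (f |: G)).
have /matchingP [FG hF] := mF.
have [eF|eF] := boolP (e \in F).
  have fF : f \notin F.
    by apply: contra nef => fF; rewrite (hF e f).
  apply: leq_add; last by apply: max_matchingS; rewrite setSD //
    subsetU // subD1set orbT.
  apply: matching_le (sub_matching mF _); apply/subsetP => g gF.
  have gf : g != f by apply: contraNneq fF => <-.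
  by have := subsetP FG g gF; rewrite !inE (negPf gf).
rewrite addnC; apply: leq_add; first by apply: max_matchingS;
  rewrite subsetU // subD1set orbT.
apply: matching_le (sub_matching mF _); apply/subsetP => g gF.
have ge : g != e by apply: contraNneq eF => <-.
by have := subsetP FG g gF; rewrite !inE (negPf ge).
Qed.

(** Either edge alone enlarges a maximum matching of [G], since its ends are isolated there, but
    both together add only one because they share [i]. *)
Lemma matching_gain_strict (K : realFieldType) n (i j k : 'I_n) (G : bigraph n) :
  j != k -> {in G, forall g, ~~ [|| g.1 == i, g.2 == j | g.2 == k]} ->
  matching_gain (i, j) ((i, k) |: G) + 1 <=
    matching_gain (i, j) (G :\ (i, k)) :> K.
Proof.
move=> jk hG; rewrite /matching_gain.
have nG g : [|| g.1 == i, g.2 == j | g.2 == k] -> g \notin G.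
  by apply: contraL => /hG.
have D1 l (H : bigraph n) : (i, l) \notin H -> H :\ (i, l) = H.
  by move=> lH; apply/setDidPl; rewrite disjoint_sym disjoints1.
have nij : (i, j) \notin (i, k) |: G.
  by rewrite !inE negb_or xpair_eqE eqxx jk /=; apply: nG; rewrite /= eqxx.
rewrite (D1 j) // (D1 k) ?(D1 j) //; try by apply: nG; rewrite /= eqxx.
have lt_j : (max_matching G < max_matching ((i, j) |: G))%N.
  apply: max_matchingU1 => g /hG; apply: contra.
  rewrite /incident /= (eq_sym i) ?(eq_sym j) ?(eq_sym k).
  by case/orP => ->; rewrite ?orbT.
have lt_k : (max_matching G < max_matching ((i, k) |: G))%N.
  apply: max_matchingU1 => g /hG; apply: contra.
  rewrite /incident /= (eq_sym i) ?(eq_sym j) ?(eq_sym k).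
  by case/orP => ->; rewrite ?orbT.
have le_jk : (max_matching ((i, j) |: ((i, k) |: G)) <= (max_matching G).+1)%N.
  have [F mF ->] := max_matchingP ((i, j) |: ((i, k) |: G)).
  have /matchingP [FG hF] := mF.
  (* [F] uses at most one of the two new edges; without it, [F] lies inside [G]. *)
  have [l Fl] : exists l, F :\ (i, l) \subset G.
    have [jF|jF] := boolP ((i, j) \in F); [exists j | exists k].
      apply/subsetP => g /setD1P [gj gF].
      have := subsetP FG g gF; rewrite !inE (negPf gj) /= => /orP [/eqP gk|//].
      case/eqP: gj; apply: hF => //.
      by rewrite gk /incident eqxx.
    apply/subsetP => g /setD1P [gk gF].
    have gj : g != (i, j) by apply: contraNneq jF => <-.
    by have := subsetP FG g gF; rewrite !inE (negPf gk) (negPf gj).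
  have mFl : is_matching G (F :\ (i, l)).
    apply/matchingP; split=> // e f /setD1P [_ eF] /setD1P [_ fF]; exact: hF.
  rewrite (cardsD1 (i, l) F) -add1n.
  exact: leq_add (leq_b1 _) (matching_le mFl).
rewrite lerBrDr [_ - _ + 1]addrC -addrA [_ - _ + _]addrAC addrA lerBlDr.
rewrite -(natrD _ _ (max_matching G)) nat1r -natrD ler_nat.
apply: leq_trans (leq_add lt_j lt_k).
by rewrite -addnS; apply: leq_add.
Qed.

Lemma card_three_lines n (i j k : 'I_n) :
  (#|[set g : 'I_n * 'I_n | [|| g.1 == i, g.2 == j | g.2 == k]]| <= 3 * n)%N.
Proof.
have -> : [set g : 'I_n * 'I_n | [|| g.1 == i, g.2 == j | g.2 == k]] =
    setX [set i] setT :|: setX setT [set j] :|: setX setT [set k].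
  by apply/setP => -[a b]; rewrite !inE andbT orbA.
apply: leq_trans (leq_card_setU _ _) _.
apply: leq_trans (leq_add (leq_card_setU _ _) (leqnn _)) _.
by rewrite !cardsX !cards1 cardsT card_ord !mul1n !muln1 2!mulSn mul1n addnA.
Qed.

(** Per unit of probability, raising [(i, k)] costs at least the probability that row [i] and
    columns [j], [k] are empty, where the gain drops by at least 1. These lines hold at most [3 * n]
    edges. *)
Lemma mean_matching_gain_le (K : realFieldType) n (i j : 'I_n)
    (p q : 'I_n * 'I_n -> K) (x : K) :
  x <= 1 -> (forall e, 0 <= p e) -> (forall e, p e <= q e) ->
  (forall e, q e <= x) ->
  (forall e, p e != q e -> incident (i, j) e && ((i, j) != e)) ->
  (\sum_(k | k != j) (q (i, k) - p (i, k))) * (1 - x) ^+ (3 * n) <=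
  random_subset_mean p (matching_gain (i, j)) -
  random_subset_mean q (matching_gain (i, j)).
Proof.
move=> x1 p0 pq qx supp.
(* For raised edges in column [j] only the sign of the effect is used, hence the bound 0. *)
pose b (e : 'I_n * 'I_n) : K :=
  if (e.1 == i) && (e.2 != j) then (1 - x) ^+ (3 * n) else 0.
have -> : (\sum_(k | k != j) (q (i, k) - p (i, k))) * (1 - x) ^+ (3 * n) =
    \sum_e (q e - p e) * b e.
  rewrite [RHS](eq_bigr (fun e => (q (e.1, e.2) - p (e.1, e.2)) * b (e.1, e.2)));
    last by case.
  rewrite -(pair_bigA _ (fun a k => (q (a, k) - p (a, k)) * b (a, k))) /=.
  rewrite [RHS](bigD1 i) //= [X in _ = _ + X]big1 ?addr0; last first.
    move=> a ai; apply: big1 => k _.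
    by rewrite /b /= (negPf ai) mulr0.
  rewrite mulr_suml [LHS]big_mkcond; apply: eq_bigr => k _.
  by rewrite /b /= eqxx /=; case: ifP => _; rewrite ?mulr0.
apply: random_subset_mean_antitone => // e r pqe prq.
have r01 f : 0 <= r f <= 1.
  have /andP [pr rq] := prq f; apply/andP; split.
    exact: le_trans (p0 f) pr.
  exact: le_trans rq (le_trans (qx f) x1).
have /andP [inc ne] := supp e pqe.
rewrite /b; case: ifP => [/andP [/eqP e1 ej]|_]; last first.
  apply: sumr_ge0 => A _; apply: mulr_ge0; first exact: subset_weight_ge0.
  by rewrite subr_ge0; apply: matching_gain_decreasing.
have {e1} -> : e = (i, e.2) by rewrite -e1 -surjective_pairing.
set k := e.2 in ej *.
pose L := [set g : 'I_n * 'I_n | [|| g.1 == i, g.2 == j | g.2 == k]].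
apply: (@le_trans _ _ (random_subset_mean r (fun A => [disjoint A & L]%:R))).
  rewrite random_subset_mean_disjoint.
  apply: (@le_trans _ _ (\prod_(e in L) (1 - x))).
    rewrite prodr_const.
    apply: ler_wiXn2l (card_three_lines i j k); first by rewrite subr_ge0.
    rewrite lerBlDr lerDl; apply: le_trans (p0 (i, j)) _.
    exact: le_trans (pq _) (qx _).
  apply: ler_prod => g _; rewrite subr_ge0 x1 /= lerD2l lerN2.
  by have /andP [_ rq] := prq g; apply: le_trans rq (qx g).
apply: random_subset_mean_le => // A.
have [dAL|_] := boolP [disjoint A & L]; last first.
  rewrite subr_ge0; apply: matching_gain_decreasing.
    by rewrite /incident eqxx.
  by rewrite xpair_eqE eqxx eq_sym.
rewrite lerBrDr addrC; apply: matching_gain_strict; first by rewrite eq_sym.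
by move=> g gA; have := disjointFr dAL gA; rewrite inE => ->.
Qed.

(** * Swapping homogeneous for typed edge probabilities *)

Definition spin (K : realFieldType) (d : K) (x : 'I_2) : K :=
  if x == 1 then - d else d.

Lemma spin_rev (K : realFieldType) (d : K) x : spin d (rev_ord x) = - spin d x.
Proof. by case: x => [[|[|//]] ?]; rewrite /spin /= ?opprK. Qed.

Definition flip_type n (i : 'I_n) (t : typing n) : typing n :=
  [ffun k => if k == i then rev_ord (t k) else t k].

Lemma flip_typeK n (i : 'I_n) : involutive (flip_type i).
Proof.
by move=> t; apply/ffunP => k; rewrite !ffunE; case: eqP => // _; rewrite rev_ordK.
Qed.

Lemma spin_flip (K : realFieldType) n (d : K) (i k : 'I_n) t :
  spin d (flip_type i t k) = if k == i then - spin d (t k) else spin d (t k).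
Proof. by rewrite ffunE; case: eqP => // _; rewrite spin_rev. Qed.

Definition flip_types n (i j : 'I_n) (t : typing n * typing n) :=
  (flip_type i t.1, flip_type j t.2).

Lemma flip_typesK n (i j : 'I_n) : involutive (flip_types i j).
Proof. by case=> a b; rewrite /flip_types !flip_typeK. Qed.

Definition spin_sum (K : realFieldType) n (d : K) (t : typing n * typing n)
    (e : 'I_n * 'I_n) : K :=
  spin d (t.1 e.1) + spin d (t.2 e.2).

(** [S] collects the edges already swapped: [set0] gives the homogeneous graph, the full set the
    typed one. *)
Definition swap_prob (K : realFieldType) n (c d : K) (S : {set 'I_n * 'I_n})
    (t : typing n * typing n) (e : 'I_n * 'I_n) : K :=
  (c + if e \in S then spin_sum d t e else 0) / n%:R.

(** A spin sum is 0 or [2 * d] up to sign, so at most [c] in absolute value. *)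
Lemma swap_prob_bounds (K : realFieldType) n (c d : K)
    (S : {set 'I_n * 'I_n}) t (e : 'I_n * 'I_n) :
  - c <= 2 * d -> 2 * d <= c -> 0 <= swap_prob c d S t e <= 2 * c / n%:R.
Proof.
move=> cd dc; rewrite /swap_prob.
have n0 : 0 <= (n%:R : K)^-1 by rewrite invr_ge0 ler0n.
by apply/andP; split; [apply: mulr_ge0 | apply: ler_wpM2r] => //;
  case: ifP => _; rewrite /spin_sum /spin; do ?[case: ifP => _]; lra.
Qed.

Lemma spin_sum_flip (K : realFieldType) n (d : K) (i j : 'I_n) t :
  spin_sum d (flip_types i j t) (i, j) = - spin_sum d t (i, j).
Proof. by rewrite /spin_sum !spin_flip !eqxx opprD. Qed.

(* Reversing both end types of [(i, j)], when these are the better connected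
   ones, removes edges in row [i] and column [j] only. *)
Lemma gain_flip_gt0 (K : realFieldType) n (i j : 'I_n) (c d : K)
    (S : {set 'I_n * 'I_n}) (t : typing n * typing n) m :
  - c <= 2 * d -> 2 * d <= c -> 2 * c <= n%:R ->
  (i, j) \notin S -> (m <= #|[set k | (i, k) \in S]|)%N ->
  0 < spin_sum d t (i, j) ->
  spin_sum d t (i, j) * (m%:R / n%:R * (1 - 2 * c / n%:R) ^+ (3 * n)) <=
  random_subset_mean (swap_prob c d S (flip_types i j t)) (matching_gain (i, j)) -
  random_subset_mean (swap_prob c d S t) (matching_gain (i, j)).
Proof.
move=> cd dc cn ijS mS; set v := spin_sum d t (i, j) => v0.
have n0 : 0 < n%:R :> K by rewrite ltr0n; apply: leq_ltn_trans (ltn_ord i).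
have x1 : 2 * c / n%:R <= 1 by rewrite ler_pdivrMr ?mul1r.
(* Opposite spins would cancel, so a positive sum forces two equal spins. *)
have [s1 s2] : spin d (t.1 i) = v / 2 /\ spin d (t.2 j) = v / 2.
  by move: v0; rewrite /v /spin_sum /spin /=; do 2?case: ifP => _; lra.
have dif e : swap_prob c d S t e - swap_prob c d S (flip_types i j t) e =
    if e \in S then ((e.1 == i)%:R + (e.2 == j)%:R) * v / n%:R else 0.
  rewrite /swap_prob -mulrBl /spin_sum !spin_flip.
  case: ifP => _; last by rewrite subrr mul0r.
  congr (_ / _).
  by have [->|_] := eqVneq e.1 i; have [->|_] := eqVneq e.2 j;
    rewrite ?s1 ?s2 /=; lra.
have le_pq e : swap_prob c d S (flip_types i j t) e <= swap_prob c d S t e.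
  rewrite -subr_ge0 dif; case: ifP => // _.
  apply: divr_ge0 (ltW n0); apply: mulr_ge0 (ltW v0).
  by apply: addr_ge0; apply: ler0n.
have b S' t' e := @swap_prob_bounds _ n c d S' t' e cd dc.
have := mean_matching_gain_le (i := i) (j := j) x1 _ le_pq.
have p0 e : 0 <= swap_prob c d S (flip_types i j t) e.
  by have /andP [] := b S (flip_types i j t) e.
have qx e : swap_prob c d S t e <= 2 * c / n%:R by have /andP [] := b S t e.
move=> /(_ p0 qx) main; apply: le_trans (main _); last first.
  (* Only swapped edges in row [i] or column [j] change, and [(i, j)] itself is not yet swapped. *)
  move=> e; rewrite eq_sym -subr_eq0 dif.
  case: ifP => [eS|]; last by rewrite eqxx.
  have -> : (i, j) != e by apply: contraNneq ijS => ->.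
  rewrite andbT; apply: contraNT; rewrite negb_or => /andP [/= ni nj].
  by rewrite ![e.1 == _]eq_sym [e.2 == _]eq_sym (negPf ni) (negPf nj) addr0 !mul0r.
(* Row [i] has at least [m] swapped edges, each losing probability [v / n]. *)
rewrite mulrA; apply: ler_wpM2r; first by apply: exprn_ge0; rewrite subr_ge0.
rewrite big_mkcond (eq_bigr (fun k => if (i, k) \in S then v / n%:R else 0)).
  rewrite -big_mkcond sumr_const mulrCA -[leRHS]mulr_natl.
  apply: ler_wpM2r; first exact: divr_ge0 (ltW v0) (ltW n0).
  rewrite ler_nat; apply: leq_trans mS _; apply: eq_leq.
  by rewrite cardsE.
move=> k _; have [->|kj] := eqVneq k j; first by rewrite (negPf ijS).
by rewrite dif /= eqxx (negPf kj) addr0 mul1r.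
Qed.

(** Multiplying by the spin sum makes the estimate independent of its sign: a negative sum becomes
    positive for the flipped typing, and both factors change sign. *)
Lemma gain_flip (K : realFieldType) n (i j : 'I_n) (c d : K)
    (S : {set 'I_n * 'I_n}) (t : typing n * typing n) m :
  - c <= 2 * d -> 2 * d <= c -> 2 * c <= n%:R ->
  (i, j) \notin S -> (m <= #|[set k | (i, k) \in S]|)%N ->
  spin_sum d t (i, j) ^+ 2 * (m%:R / n%:R * (1 - 2 * c / n%:R) ^+ (3 * n)) <=
  spin_sum d t (i, j) *
  (random_subset_mean (swap_prob c d S (flip_types i j t)) (matching_gain (i, j)) -
   random_subset_mean (swap_prob c d S t) (matching_gain (i, j))).
Proof.
move=> cd dc cn ijS mS.
have [v0|v0|v0] := ltrgtP 0 (spin_sum d t (i, j)).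
- rewrite expr2 -[leLHS]mulrA; apply: ler_wpM2l; first exact: ltW.
  exact: gain_flip_gt0.
- have := @gain_flip_gt0 _ n i j c d S (flip_types i j t) m cd dc cn ijS mS.
  rewrite flip_typesK spin_sum_flip oppr_gt0 => /(_ v0) h.
  rewrite -[leRHS]mulrNN opprB -sqrrN expr2 -[leLHS]mulrA.
  by apply: ler_wpM2l; rewrite ?oppr_ge0 ?(ltW v0).
- by rewrite -v0 expr0n /= !mul0r.
Qed.

(** Left unnormalized: fair spins give every typing the same weight. *)
Definition swap_mean (K : realFieldType) n (c d : K) (S : {set 'I_n * 'I_n}) : K :=
  \sum_(t : typing n * typing n)
    random_subset_mean (swap_prob c d S t) (fun G => (max_matching G)%:R).

(** Each squared spin is [d ^+ 2], and the cross terms cancel because flipping one type reverses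
    their sign. *)
Lemma sum_spin_sum_sqr (K : realFieldType) n (d : K) (e : 'I_n * 'I_n) :
  \sum_(t : typing n * typing n) spin_sum d t e ^+ 2 =
  #|{: typing n * typing n}|%:R * (2 * d ^+ 2).
Proof.
have sq (x : 'I_2) : spin d x ^+ 2 = d ^+ 2.
  by rewrite /spin; case: ifP; rewrite ?sqrrN.
have zero : \sum_(t : typing n * typing n) spin d (t.1 e.1) * spin d (t.2 e.2) = 0.
  rewrite -(pair_bigA _
    (fun tL tR : typing n => spin d (tL e.1) * spin d (tR e.2))) /=.
  apply: big1 => tL _; rewrite -mulr_sumr.
  suff -> : \sum_(tR : typing n) spin d (tR e.2) = 0 by rewrite mulr0.
  set s := LHS; suff : s = - s by lra.
  rewrite {1}/s (reindex_inj (inv_inj (@flip_typeK n e.2))) -sumrN.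
  by apply: eq_bigr => tR _; rewrite spin_flip eqxx.
transitivity (\sum_(t : typing n * typing n)
    (2 * d ^+ 2 + 2 * (spin d (t.1 e.1) * spin d (t.2 e.2)))).
  by apply: eq_bigr => t _; rewrite /spin_sum sqrrD !sq; ring.
by rewrite big_split /= -[X in _ + X]mulr_sumr zero mulr0 addr0 sumr_const
  -[LHS]mulr_natl.
Qed.

(** By Russo's formula the loss is a sum of [- v t * X t] over typings. Averaging it with its image
    under the double flip gives half of [v t * (X (flip_types i j t) - X t)], which [gain_flip]
    bounds; the half cancels the 2 in the second moment of the spin sum. *)
Lemma swap_step (K : realFieldType) n (i j : 'I_n) (c d : K)
    (S : {set 'I_n * 'I_n}) m :
  - c <= 2 * d -> 2 * d <= c -> 2 * c <= n%:R ->
  (i, j) \notin S -> (m <= #|[set k | (i, k) \in S]|)%N ->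
  #|{: typing n * typing n}|%:R * d ^+ 2 / n%:R *
    (m%:R / n%:R * (1 - 2 * c / n%:R) ^+ (3 * n)) <=
  swap_mean c d S - swap_mean c d ((i, j) |: S).
Proof.
move=> cd dc cn ijS mS; set g := _ / _ * _ ^+ _.
have n0 : 0 < n%:R :> K by rewrite ltr0n; apply: leq_ltn_trans (ltn_ord i).
pose X t := random_subset_mean (swap_prob c d S t) (matching_gain (i, j)).
pose v (t : typing n * typing n) := spin_sum d t (i, j).
have dif : swap_mean c d S - swap_mean c d ((i, j) |: S) =
    n%:R^-1 * \sum_t - v t * X t.
  rewrite /swap_mean -sumrB mulr_sumr; apply: eq_bigr => t _.
  rewrite -opprB (@random_subset_mean_diff1 _ _ _ (swap_prob c d S t) _ (i, j)).
    rewrite /swap_prob setU11 (negPf ijS).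
    by rewrite -/(matching_gain (i, j)) -/(X t) -/(v t); ring.
  by move=> e ne; rewrite /swap_prob in_setU1 (negPf ne).
have dif' : \sum_t - v t * X t = \sum_t v t * X (flip_types i j t).
  rewrite (reindex_inj (inv_inj (@flip_typesK n i j))).
  by apply: eq_bigr => t _; rewrite /v spin_sum_flip opprK.
have : \sum_t v t ^+ 2 * g <= \sum_t v t * (X (flip_types i j t) - X t).
  by apply: ler_sum => t _; apply: gain_flip.
under [leRHS]eq_bigr => t _ do rewrite mulrBr -mulNr.
rewrite big_split /= -dif' -mulr_suml sum_spin_sum_sqr => h.
rewrite dif [_ / n%:R]mulrC -mulrA; apply: ler_wpM2l; first by rewrite invr_ge0 ltW.
lra.
Qed.

(** Iterates [swap_step] over [T]; the rows of the swapped set only grow, so the bound [m]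
    persists. *)
Lemma swap_many (K : realFieldType) n (c d : K) (S T : {set 'I_n * 'I_n}) m :
  - c <= 2 * d -> 2 * d <= c -> 2 * c <= n%:R ->
  [disjoint S & T] -> (forall i, m <= #|[set k | (i, k) \in S]|)%N ->
  #|T|%:R * (#|{: typing n * typing n}|%:R * d ^+ 2 / n%:R *
    (m%:R / n%:R * (1 - 2 * c / n%:R) ^+ (3 * n))) <=
  swap_mean c d S - swap_mean c d (S :|: T).
Proof.
move=> cd dc cn dST mS; set g := (X in _ * X <= _).
have [r] := ubnP #|T|; elim: r T dST => // r IH T dST /ltnSE cT.
have [->|/set0Pn [e eT]] := eqVneq T set0.
  by rewrite cards0 mul0r setU0 subrr.
have sT : T :\ e \subset T by apply: subD1set.
have dST' : [disjoint S & T :\ e] by apply: disjointWr dST.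
have {}IH := IH _ dST' (leq_trans (proper_card (properD1 eT)) cT).
have eS : e \notin S :|: T :\ e.
  by rewrite !inE eqxx orbF (disjointFl dST eT).
have ST : S :|: T = e |: (S :|: T :\ e).
  by rewrite setUCA setD1K.
rewrite (cardsD1 e) eT natrD mulrDl mul1r ST.
case: e eS {eT sT dST' ST} IH => i j eS IH.
have step : g <= swap_mean c d (S :|: T :\ (i, j)) -
    swap_mean c d ((i, j) |: (S :|: T :\ (i, j))).
  apply: swap_step => //; apply: leq_trans (mS i) _.
  by apply/subset_leq_card/subsetP => k; rewrite !inE => ->.
lra.
Qed.

Lemma card_ord_lt n m : (m <= n)%N -> #|[set k : 'I_n | (k < m)%N]| = m.
Proof.
by move=> mn; rewrite -sum1dep_card (big_ord_narrow mn) sum1_card card_ord.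
Qed.

(* Swapping the edges of the first half of the columns loses nothing, and makes
   each of the remaining swaps lose order [1 / n] per typing. *)
Lemma swap_all (K : realFieldType) n (c d : K) :
  - c <= 2 * d -> 2 * d <= c -> 2 * c <= n%:R -> (1 < n)%N ->
  #|{: typing n * typing n}|%:R *
    (d ^+ 2 * (1 - 2 * c / n%:R) ^+ (3 * n) / 6 * n%:R) <=
  swap_mean c d (set0 : {set 'I_n * 'I_n}) - swap_mean c d [set: 'I_n * 'I_n].
Proof.
move=> cd dc cn n1; pose m := n./2.
have mn : (m <= n)%N by rewrite /m; lia.
pose A := [set e : 'I_n * 'I_n | (e.2 < m)%N].
have AT : A :|: ~: A = setT by apply: setUCr.
(* With [m = 0] the bound is 0, which says that the first half of the swaps does not raise the
   mean. *)
have c1 := @swap_many K n c d set0 A 0 cd dc cn _ (fun i => leq0n _).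
have {}c1 : 0 <= swap_mean c d (set0 : {set 'I_n * 'I_n}) - swap_mean c d A.
  move: c1; rewrite set0U !mul0r !mulr0; apply.
  by rewrite -setI_eq0 set0I.
have := @swap_many K n c d A (~: A) m cd dc cn.
rewrite -setI_eq0 setICr eqxx AT => /(_ isT) c2.
have rows : forall i : 'I_n, (m <= #|[set k | (i, k) \in A]|)%N.
  move=> i; rewrite -[leqLHS](card_ord_lt mn).
  by apply/subset_leq_card/subsetP => k; rewrite !inE.
have {c2 rows} c2 := c2 rows.
have cA : #|~: A| = (n * (n - m))%N.
  have -> : ~: A = setX setT (~: [set k : 'I_n | (k < m)%N]).
    by apply/setP => -[a b]; rewrite !inE.
  by rewrite cardsX cardsT card_ord cardsCs setCK card_ord card_ord_lt.
suff : #|{: typing n * typing n}|%:R *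
    (d ^+ 2 * (1 - 2 * c / n%:R) ^+ (3 * n) / 6 * n%:R) <=
    #|~: A|%:R * (#|{: typing n * typing n}|%:R * d ^+ 2 / n%:R *
    (m%:R / n%:R * (1 - 2 * c / n%:R) ^+ (3 * n))) by lra.
rewrite {}cA; set N := #|_|%:R; set w := _ ^+ (3 * n).
have n0 : 0 < n%:R :> K by rewrite ltr0n; lia.
have w0 : 0 <= N * (d ^+ 2 * w).
  apply: mulr_ge0; first exact: ler0n.
  apply: mulr_ge0; first exact: sqr_ge0.
  by apply: exprn_ge0; rewrite subr_ge0 ler_pdivrMr ?mul1r.
(* The 6 comes from [n <= 2 * (n - m)] and [n <= 3 * m], the latter because [m] is [n / 2] rounded
   down and [n] is at least 2. *)
have mm : n%:R ^+ 2 <= 6 * ((n - m)%:R * m%:R) :> K.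
  rewrite -natrX -!natrM ler_nat.
  have n2 : (n <= 2 * (n - m))%N by rewrite /m; lia.
  have n3 : (n <= 3 * m)%N by rewrite /m; lia.
  have := leq_mul n2 n3; rewrite mulnn; lia.
have -> : N * (d ^+ 2 * w / 6 * n%:R) = N * (d ^+ 2 * w) / (6 * n%:R) * n%:R ^+ 2.
  by field; rewrite lt0r_neq0.
have -> : (n * (n - m))%:R * (N * d ^+ 2 / n%:R * (m%:R / n%:R * w)) =
    N * (d ^+ 2 * w) / (6 * n%:R) * (6 * ((n - m)%:R * m%:R)).
  by rewrite natrM; field; rewrite lt0r_neq0.
apply: ler_wpM2l mm; apply: divr_ge0 => //.
by rewrite mulr_ge0 ?ler0n // ltW.
Qed.

(** * Limits *)

Lemma LimSup_seq_gap (u v : nat -> R) (lo hi gap : R) :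
  (forall n, lo <= u n <= hi) -> (forall n, lo <= v n <= hi) ->
  (exists N, forall n, (N <= n)%N -> u n + gap <= v n) ->
  exists a b, [/\ LimSup_seq u = Finite a, LimSup_seq v = Finite b & a + gap <= b].
Proof.
move=> ub vb [N uv].
have fin (w : nat -> R) : (forall n, lo <= w n <= hi) ->
    exists2 a, LimSup_seq w = Finite a & is_LimSup_seq w (Finite a).
  move=> wb; have hw : is_LimSup_seq w (LimSup_seq w).
    by rewrite /LimSup_seq; case: ex_LimSup_seq.
  have wlo : Rbar_le lo (LimSup_seq w).
    rewrite -(LimSup_seq_const lo); apply: LimSup_le; exists 0%N => n _.
    by apply/RleP; have /andP [] := wb n.
  have whi : Rbar_le (LimSup_seq w) hi.
    rewrite -(LimSup_seq_const hi); apply: LimSup_le; exists 0%N => n _.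
    by apply/RleP; have /andP [] := wb n.
  by case: (LimSup_seq w) hw wlo whi => // a hw _ _; exists a.
have [a ua ha] := fin u ub; have [b vb' hb] := fin v vb.
(* Infinitely often [u] exceeds [a - e / 2], while eventually [v] is below [b + e / 2]; a common
   index compares [a + gap] with [b + e]. *)
exists a, b; split=> //; apply/ler_addgt0Pr => e e0.
have /RltP e2 : 0 < e / 2 by rewrite divr_gt0.
have [_ [N' hN']] := hb (mkposreal _ e2).
have [/(_ (maxn N N')) [n [/ssrnat.leP nNN /RltP au]] _] := ha (mkposreal _ e2).
move: nNN; rewrite geq_max => /andP [nN /ssrnat.leP nN'].
have /RltP /= vb2 := hN' n nN'.
have := uv n nN.
move: au vb2; rewrite /= RminusE RplusE; lra.
Qed.

(** [Lim_seq] is the average of the upper and lower limits, so the gap is shown for both; the lower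
    one follows from the opposite sequences in exchanged order. *)
Lemma Lim_seq_gap (u v : nat -> R) (gap : R) :
  (forall n, 0 <= u n <= 1) -> (forall n, 0 <= v n <= 1) ->
  (exists N, forall n, (N <= n)%N -> u n + gap <= v n) ->
  real (Lim_seq u) + gap <= real (Lim_seq v).
Proof.
move=> ub vb uv; have [a [b [ua vb' ab]]] := LimSup_seq_gap ub vb uv.
have opp_bounds (w : nat -> R) n : 0 <= w n <= 1 -> -1 <= - w n <= 0 by lra.
have [| | |a' [b' []]] := @LimSup_seq_gap
  (fun n => Ropp (v n)) (fun n => Ropp (u n)) (-1) 0 gap.
- by move=> n; apply: opp_bounds.
- by move=> n; apply: opp_bounds.
- have [N uvN] := uv; exists N => n /uvN.
  by rewrite !RoppE; lra.
rewrite !LimSup_seq_opp => va' ub' ab'.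
have LimInfE (w : nat -> R) x : Rbar_opp (LimInf_seq w) = Finite x ->
    LimInf_seq w = Finite (- x).
  by move=> wx; rewrite -[LimInf_seq w]Rbar_opp_involutive wx.
rewrite /Lim_seq ua vb' (LimInfE _ _ ub') (LimInfE _ _ va') /= !RdivE.
change ((a - b') / 2 + gap <= (b - a') / 2); lra.
Qed.

(** * The two allocations *)

Definition conditional_mean (C : 'M[R]_2) n (t : typing n * typing n) : R :=
  random_subset_mean (fun e => edge_prob C n (t.1 e.1) (t.2 e.2))
    (fun G => (max_matching G)%:R).

Lemma expected_max_matchingE (bL bR : R) (C : 'M[R]_2) n :
  expected_max_matching bL bR C n =
  \sum_(t : typing n * typing n)
    typing_prob bL t.1 * typing_prob bR t.2 * conditional_mean C t.
Proof.
rewrite -(pair_bigA _ (fun tL tR => typing_prob bL tL * typing_prob bR tR *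
  conditional_mean C (tL, tR))) /=.
apply: eq_bigr => tL _; apply: eq_bigr => tR _.
rewrite mulr_sumr; apply: eq_bigr => G _.
rewrite -mulrA /graph_prob pair_bigA; congr (_ * (_ * _)).
by apply: eq_bigr; case.
Qed.

Lemma typing_prob_ge0 (b : R) n (t : typing n) :
  0 <= b <= 1 -> 0 <= typing_prob b t.
Proof. by move=> b01; apply: prodr_ge0 => i _; case: ifP => _; lra. Qed.

Lemma sum_typing_prob (b : R) n : \sum_(t : typing n) typing_prob b t = 1.
Proof.
rewrite /typing_prob -(bigA_distr_bigA
  (fun (_ : 'I_n) (x : 'I_2) => if x == 1 then b else 1 - b)).
by apply: big1 => i _; rewrite big_ord_recl big_ord1 /= subrK.
Qed.

Lemma edge_prob_bounds (C : 'M[R]_2) n x y :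
  (forall x y, 0 <= C x y) -> 0 <= edge_prob C n x y <= 1.
Proof.
move=> C0; rewrite /edge_prob ge_min lexx /= le_min ler01 /=.
by rewrite divr_ge0 // ler0n.
Qed.

Lemma expected_max_matching_bounds (bL bR : R) (C : 'M[R]_2) n :
  0 <= bL <= 1 -> 0 <= bR <= 1 -> (forall x y, 0 <= C x y) ->
  0 <= expected_max_matching bL bR C n / n%:R <= 1.
Proof.
move=> bL01 bR01 C0; rewrite expected_max_matchingE.
have w0 (t : typing n * typing n) : 0 <= typing_prob bL t.1 * typing_prob bR t.2.
  by apply: mulr_ge0; apply: typing_prob_ge0.
have p01 (t : typing n * typing n) (e : 'I_n * 'I_n) :=
  edge_prob_bounds n (t.1 e.1) (t.2 e.2) C0.
have m0 t : 0 <= @conditional_mean C n t.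
  apply: sumr_ge0 => G _; apply: mulr_ge0; last exact: ler0n.
  exact/subset_weight_ge0/p01.
have m1 t : @conditional_mean C n t <= n%:R.
  apply: (@le_trans _ _ (random_subset_mean
    (fun e => edge_prob C n (t.1 e.1) (t.2 e.2)) (fun=> n%:R))).
    by apply: random_subset_mean_le (p01 t) _ => G; rewrite ler_nat max_matching_le.
  by rewrite /random_subset_mean -mulr_suml sum_subset_weight mul1r.
apply/andP; split.
  by apply: divr_ge0 (ler0n _ _); apply: sumr_ge0 => t _; apply: mulr_ge0.
(* At [n = 0] the quotient is 0, the inverse of 0 being 0. *)
have [->|n0] := posnP n; first by rewrite invr0 mulr0 ler01.
rewrite ler_pdivrMr ?ltr0n // mul1r.
apply: (@le_trans _ _ (\sum_(t : typing n * typing n)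
    typing_prob bL t.1 * typing_prob bR t.2 * n%:R)).
  by apply: ler_sum => t _; apply: ler_wpM2l.
rewrite -mulr_suml -(pair_bigA _
  (fun tL tR : typing n => typing_prob bL tL * typing_prob bR tR)) /=.
under eq_bigr => tL _ do rewrite -mulr_sumr sum_typing_prob mulr1.
by rewrite sum_typing_prob mul1r.
Qed.

(* Arguments of type [R] are parsed in [R_scope] by default; [%R] is
   [ring_scope] here. *)
Lemma typing_prob_half n (t : typing n) : typing_prob 2^-1%R t = 2^-1 ^+ n.
Proof.
rewrite /typing_prob (eq_bigr (fun=> 2^-1)) ?prodr_const ?card_ord //.
by move=> i _; case: ifP => _ //; field.
Qed.

Lemma typing_prob_const (b : bool) n (t : typing n) :
  typing_prob (b%:R)%R t = (t == [ffun=> if b then 1 else 0])%:R.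
Proof.
have [->|ne] := eqVneq.
  by apply: big1 => i _; rewrite ffunE; case: b => //=; rewrite subr0.
have /existsP [i ti] : [exists i, t i != if b then 1 else 0].
  apply: contraNT ne; rewrite negb_exists => /forallP h.
  by apply/eqP/ffunP => i; rewrite ffunE; apply/eqP/negPn/h.
rewrite /typing_prob (bigD1 i) //=.
suff -> : (if t i == 1 then b%:R else 1 - b%:R : R) = 0 by rewrite mul0r.
by case: b ti {ne} => /=; case: (t i) => [[|[|//]] ?] //= _; apply: subrr.
Qed.

Lemma flex_mx_spin (alpha alphaf : R) (x y : 'I_2) :
  flex_mx alpha alphaf x y =
  alpha + alphaf + spin ((alpha - alphaf) / 2) x + spin ((alpha - alphaf) / 2) y.
Proof.
rewrite mxE /spin.
by case: x => [[|[|//]] ?]; case: y => [[|[|//]] ?] /=; lra.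
Qed.

(** Every entry of the matrix is at most [2 * (alpha + alphaf)], so the truncation at 1 is
    inactive. *)
Lemma edge_prob_flex (alpha alphaf : R) n (x y : 'I_2) :
  0 <= alpha -> 0 <= alphaf -> 2 * (alpha + alphaf) <= n%:R ->
  edge_prob (flex_mx alpha alphaf) n x y =
  (alpha + alphaf +
    (spin ((alpha - alphaf) / 2) x + spin ((alpha - alphaf) / 2) y)) / n%:R.
Proof.
move=> a0 f0 cn; rewrite /edge_prob flex_mx_spin addrA; apply/min_idPr.
have := ler0n R n; rewrite le_eqVlt => /predU1P [<-|n0].
  by rewrite invr0 mulr0 ler01.
rewrite ler_pdivrMr // mul1r; apply: le_trans cn.
by rewrite /spin; do 2?case: ifP => _; lra.
Qed.

(** All supply nodes are flexible and all demand nodes regular, so the spins at the two ends of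
    every edge cancel. *)
Lemma OS_swap_mean (alpha alphaf : R) n :
  0 <= alpha -> 0 <= alphaf -> 2 * (alpha + alphaf) <= n%:R ->
  #|{: typing n * typing n}|%:R *
    expected_max_matching 1%R 0%R (flex_mx alpha alphaf) n =
  swap_mean (alpha + alphaf) ((alpha - alphaf) / 2) (set0 : {set 'I_n * 'I_n}).
Proof.
move=> a0 f0 cn; pose t1 : typing n * typing n := ([ffun=> 1], [ffun=> 0]).
rewrite expected_max_matchingE (bigD1 t1) //= big1 ?addr0; last first.
  move=> [tL tR]; rewrite xpair_eqE /= (typing_prob_const true).
  rewrite (typing_prob_const false) negb_and.
  by case/orP => /negPf ->; rewrite ?mulr0 !mul0r.
rewrite (typing_prob_const true) (typing_prob_const false) !eqxx !mul1r.
rewrite mulr_natl -sumr_const; apply: eq_bigr => t _.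
apply: eq_random_subset_mean => e; rewrite /swap_prob inE /= !ffunE.
rewrite edge_prob_flex // /spin /=; congr (_ / _); lra.
Qed.

(** Each pair of typings has probability [2^-1 ^+ n] squared, the inverse of the number of pairs. *)
Lemma TS_swap_mean (alpha alphaf : R) n :
  0 <= alpha -> 0 <= alphaf -> 2 * (alpha + alphaf) <= n%:R ->
  #|{: typing n * typing n}|%:R *
    expected_max_matching 2^-1%R 2^-1%R (flex_mx alpha alphaf) n =
  swap_mean (alpha + alphaf) ((alpha - alphaf) / 2) [set: 'I_n * 'I_n].
Proof.
move=> a0 f0 cn; rewrite expected_max_matchingE mulr_sumr; apply: eq_bigr => t _.
rewrite !typing_prob_half card_prod !card_ffun !card_ord natrM natrX.
have ab : 2%:R ^+ n * 2^-1 ^+ n = 1 :> R.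
  by rewrite -exprMn divff ?expr1n // pnatr_eq0.
transitivity ((2%:R ^+ n * 2^-1 ^+ n) ^+ 2 *
    conditional_mean (flex_mx alpha alphaf) t); first by ring.
rewrite ab expr1n mul1r.
apply: eq_random_subset_mean => e.
by rewrite /swap_prob inE /= edge_prob_flex.
Qed.

Lemma exp_le_pow_1B (x : R) m : 0 <= x -> 2 * x <= 1 ->
  exp ((- (2 * x)) *+ m)%R <= (1 - x) ^+ m.
Proof.
move=> x0 x1; rewrite -expRX; apply: lerXn2r; rewrite ?nnegrE.
- by apply/ltW/RltP/exp_pos.
- lra.
have e1 : exp (2 * x)%R * exp (- (2 * x))%R = 1.
  by rewrite expRD RplusE subrr expR0.
have e2 : 1 + 2 * x <= exp (2 * x)%R by apply/RleP/exp_ineq1_le.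
have e0 : 0 < exp (2 * x)%R by apply/RltP/exp_pos.
rewrite -(ler_pM2l e0) e1.
(* The product equals [1 + x * (1 - 2 * x)]. *)
have h : 1 <= (1 + 2 * x) * (1 - x) by nra.
by apply: le_trans h _; apply: ler_wpM2r => //; lra.
Qed.

Lemma OS_TS_gap (alpha alphaf : R) n :
  0 <= alpha -> 0 <= alphaf -> 4 * (alpha + alphaf) <= n%:R -> (1 < n)%N ->
  expected_max_matching 2^-1%R 2^-1%R (flex_mx alpha alphaf) n / n%:R +
    ((alpha - alphaf) / 2) ^+ 2 * exp (- (12 * (alpha + alphaf)))%R / 6 <=
  expected_max_matching 1%R 0%R (flex_mx alpha alphaf) n / n%:R.
Proof.
move=> a0 f0 c4 n1; set c := alpha + alphaf in c4 *.
have c0 : 0 <= c by apply: addr_ge0.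
have n0 : 0 < n%:R :> R by rewrite ltr0n; apply: ltn_trans n1.
have c2 : 2 * c <= n%:R by apply: le_trans c4; lra.
set d := (alpha - alphaf) / 2.
have [cd dc] : - c <= 2 * d /\ 2 * d <= c by rewrite /c /d; lra.
have := swap_all cd dc c2 n1.
rewrite -OS_swap_mean // -TS_swap_mean // -mulrBr ler_pM2l; last first.
  by rewrite ltr0n; apply/card_gt0P; exists ([ffun=> 0], [ffun=> 0]).
move=> h; rewrite -lerBrDl -mulrBl ler_pdivlMr //; apply: le_trans h.
apply: ler_wpM2r; first exact: ltW.
apply: ler_wpM2r; first by rewrite invr_ge0 ler0n.
apply: ler_wpM2l; first exact: sqr_ge0.
(* Here [x = 2 * c / n] and the exponent is [3 * n], so [n] cancels and leaves [12 * c];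
   [2 * x <= 1] is the assumption [4 * c <= n]. *)
have := @exp_le_pow_1B (2 * c / n%:R)%R (3 * n).
have -> : (- (2 * (2 * c / n%:R))) *+ (3 * n) = - (12 * c) :> R.
  by rewrite -[LHS]mulr_natr natrM; field; rewrite lt0r_neq0.
apply; first by apply: divr_ge0 (ltW n0); apply: mulr_ge0 (ler0n _ 2) c0.
by rewrite mulrA ler_pdivrMr // mul1r; apply: le_trans c4; lra.
Qed.

Theorem theorem2 (alpha alphaf : R) (alpha_ge0 : 0 <= alpha)
    (alphaf_ge0 : 0 <= alphaf) :
  eta_OS 1 alpha alphaf >= eta_TS 1 alpha alphaf /\
  (alpha <> alphaf -> eta_OS 1 alpha alphaf > eta_TS 1 alpha alphaf).
Proof.
set g := ((alpha - alphaf) / 2) ^+ 2 * exp (- (12 * (alpha + alphaf)))%R / 6.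
(* The budget is halved by Stdlib's division, here turned into the MathComp inverse. *)
have half : Rdiv 1 2 = 2^-1%R by rewrite RdivE; apply: div1r.
(* The gap [g] is free of [n], nonnegative, and positive as soon as [alpha] and [alphaf] differ. *)
suff gap : eta_TS 1 alpha alphaf + g <= eta_OS 1 alpha alphaf.
  have e0 : 0 < exp (- (12 * (alpha + alphaf)))%R by apply/RltP/exp_pos.
  split=> [|ne].
    apply: le_trans gap; rewrite lerDl; apply: divr_ge0 (ler0n _ 6).
    exact: mulr_ge0 (sqr_ge0 _) (ltW e0).
  apply: lt_le_trans gap; rewrite ltrDl; apply: divr_gt0; last by rewrite ltr0n.
  apply: mulr_gt0 e0; rewrite exprn_even_gt0 //= mulf_neq0 ?invr_eq0 ?pnatr_eq0 //.
  by rewrite subr_eq0; apply/eqP.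
rewrite /eta_OS /eta_TS /eta half.
have C0 x y : 0 <= flex_mx alpha alphaf x y.
  by rewrite flex_mx_spin /spin; do 2?case: ifP => _; lra.
apply: Lim_seq_gap => [n|n|].
- have h01 : 0 <= (2^-1 : R) <= 1 by rewrite invr_ge0 ler0n invf_le1 ?ler1n ?ltr0n.
  exact: expected_max_matching_bounds.
- by apply: expected_max_matching_bounds; rewrite // ?ler01 ?lexx.
(* From this index on, [n] is at least 2 and at least [4 * (alpha + alphaf)]. *)
exists (maxn 2 (Num.trunc (4 * (alpha + alphaf))).+1) => n.
rewrite geq_max => /andP [n1 cn]; apply: OS_TS_gap => //.
apply: ltW; apply: lt_le_trans (truncnS_gt _) _.
by rewrite ler_nat.
Qed.
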